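(* Let $(\Omega,d)$ be a compact metric space, let $k\ge 1$ and let $F$ be a $k$-iterated contraction system on $\Omega$ with contraction ratio $\theta\in(0,1)$, such that $\Omega$ is the attractor of $F$ (i.e. $\Omega$ is the union of the underlying sets of the multisets $F(x)$, $x\in\Omega$). Let $A:\Omega\to\mathbb{R}$ be Lipschitz, let $\mathscr{L}$ be the associated transfer operator with spectral radius $\rho$ on $C(\Omega)$, let $h:\Omega\to\mathbb{R}$ be a strictly positive Lipschitz function with $\mathscr{L}h=\rho h$, and let $\mathbb{P}$ be the normalized operator $\mathbb{P}\varphi(x)=\mathscr{L}(h\varphi)(x)/(\rho h(x))$ with dual $\mathbb{P}^*$. Then there exist constants $C>0$ and $\lambda\in(0,1)$, depending only on $\theta$, $\operatorname{Lip}(A)$ and $\operatorname{diam}\Omega$, such that for all $n\in\mathbb{N}$ and all Borel probability measures $\mu,\nu$ on $\Omega$, \[W_1((\mathbb{P}^* )^n\mu,(\mathbb{P}^* )^n\nu)\le C\lambda^n W_1(\mu,\nu).\]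
   Context: A $k$-multiset of elements of $\Omega$ is an unordered list of $k$ elements of $\Omega$ with repetitions allowed (the orbit of a $k$-tuple under permutations); its underlying set is the set of its elements; sums over a multiset count each element with its multiplicity. A bijection between $k$-multisets $F(x)$ and $F(y)$ is a choice of $k$ pairs $(x_i,y_i)$ with $F(x)=\{x_1,\dots,x_k\}$ and $F(y)=\{y_1,\dots,y_k\}$. A $k$-iterated contraction system (ICS) on $\Omega$ with contraction ratio $\theta\in(0,1)$ is a map $F$ assigning to each $x\in\Omega$ a $k$-multiset $F(x)$ of elements of $\Omega$ such that for all $x,y\in\Omega$ there is a bijection $(x_i,y_i)_{i=1}^k$ between $F(x)$ and $F(y)$ with $d(x_i,y_i)\le\theta d(x,y)$ for all $i$. For a continuous potential $A$, the transfer operator acts on continuous $f:\Omega\to\mathbb{R}$ by $\mathscr{L}f(x)=\sum_{y\in F(x)}e^{A(y)}f(y)$ (sum over the multiset), and $\rho$ denotes its spectral radius on $C(\Omega)$ with the sup norm. The dual $\mathbb{P}^*$ acts on finite signed Borel measures by $\int\varphi\,d(\mathbb{P}^*\mu)=\int\mathbb{P}\varphi\,d\mu$ for continuous $\varphi$; it maps probability measures to probability measures. $W_1(\mu,\nu)=\inf_{\pi}\int d(x,y)\,d\pi(x,y)$, the infimum over couplings $\pi$ of $\mu$ and $\nu$ (measures on $\Omega\times\Omega$ with marginals $\mu,\nu$). *)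

(* Defs.v *)
From HB Require Import structures.
From mathcomp Require Import all_boot all_order all_algebra perm.
From mathcomp Require Import all_classical all_reals all_analysis.
Set Implicit Arguments. Unset Strict Implicit. Unset Printing Implicit Defensive.
Import Order.TTheory GRing.Theory Num.Theory.
Import numFieldNormedType.Exports.
Local Open Scope classical_set_scope.
Local Open Scope ring_scope.

Section Defs.
Variable R : realType.

Definition is_metric (T : Type) (dist : T -> T -> R) : Prop :=
  (forall x y, 0 <= dist x y) /\
  (forall x y, dist x y = 0 <-> x = y) /\
  (forall x y, dist x y = dist y x) /\
  (forall x y z, dist x z <= dist x y + dist y z).

Definition dopen (T : Type) (dist : T -> T -> R) (U : set T) : Prop :=
  forall x, U x -> exists2 e : R, 0 < e & forall y, dist x y < e -> U y.

Definition dcompact (T : Type) (dist : T -> T -> R) : Prop :=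
  forall G : set (set T), (forall U, G U -> dopen dist U) ->
    (forall x, exists2 U, G U & U x) ->
    exists (n : nat) (V : 'I_n -> set T), (forall i, G (V i)) /\
      (forall x, exists i, V i x).

Definition is_borel (d : measure_display) (T : measurableType d)
  (dist : T -> T -> R) : Prop :=
  (@measurable d T) = <<s [set U : set T | dopen dist U] >>.

Definition dcontinuous (T : Type) (dist : T -> T -> R) (f : T -> R) : Prop :=
  forall x (e : R), 0 < e -> exists2 del : R, 0 < del &
    forall y, dist x y < del -> `|f x - f y| < e.

Definition is_lipschitz (T : Type) (dist : T -> T -> R) (f : T -> R) : Prop :=
  exists L : R, forall x y, `|f x - f y| <= L * dist x y.

Definition lipconst (T : Type) (dist : T -> T -> R) (f : T -> R) : R :=
  sup [set `|f p.1 - f p.2| / dist p.1 p.2 | p in [set p : T * T | p.1 <> p.2]].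

Definition mdiam (T : Type) (dist : T -> T -> R) : R :=
  sup [set dist p.1 p.2 | p in [set: T * T]].

(* A k-multiset of elements of T is represented by a map 'I_k -> T
   (an ordered list of k elements, considered up to permutation of 'I_k);
   a bijection between F x and F y is a permutation of 'I_k. *)
Definition is_ICS (T : Type) (dist : T -> T -> R) (k : nat)
  (F : T -> 'I_k -> T) (theta : R) : Prop :=
  0 < theta < 1 /\
  forall x y, exists s : {perm 'I_k},
    forall i, dist (F x i) (F y (s i)) <= theta * dist x y.

Definition is_attractor (T : Type) (k : nat) (F : T -> 'I_k -> T) : Prop :=
  forall z, exists x, exists i, F x i = z.

Definition transfer (T : Type) (k : nat) (F : T -> 'I_k -> T) (A : T -> R)
  (f : T -> R) : T -> R :=
  fun x => \sum_(i < k) expR (A (F x i)) * f (F x i).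

Definition supnorm (T : Type) (f : T -> R) : R := sup [set `|f x| | x in [set: T]].

Definition opnorm (T : Type) (dist : T -> T -> R) (Lop : (T -> R) -> (T -> R)) : R :=
  sup [set supnorm (Lop f) |
        f in [set f : T -> R | dcontinuous dist f /\ supnorm f <= 1]].

(* spectral radius on (C(T), sup norm), via Gelfand's formula *)
Definition spectral_radius_is (T : Type) (dist : T -> T -> R)
  (Lop : (T -> R) -> (T -> R)) (rho : R) : Prop :=
  (fun n : nat => opnorm dist (iter n Lop) `^ (n%:R^-1)) @ \oo --> rho.

Definition normalized (T : Type) (k : nat) (F : T -> 'I_k -> T) (A h : T -> R)
  (rho : R) (phi : T -> R) : T -> R :=
  fun x => transfer F A (fun y => h y * phi y) x / (rho * h x).

Definition is_dual_image (d : measure_display) (T : measurableType d)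
  (dist : T -> T -> R) (P : (T -> R) -> (T -> R))
  (nu nu' : probability T R) : Prop :=
  forall phi : T -> R, dcontinuous dist phi ->
    (\int[nu']_x (phi x)%:E = \int[nu]_x (P phi x)%:E)%E.

Definition coupling (d : measure_display) (T : measurableType d)
  (mu nu : probability T R) (pi : probability (T * T)%type R) : Prop :=
  (forall B : set T, measurable B -> pi (fst @^-1` B) = mu B) /\
  (forall B : set T, measurable B -> pi (snd @^-1` B) = nu B).

Definition W1 (d : measure_display) (T : measurableType d)
  (dist : T -> T -> R) (mu nu : probability T R) : \bar R :=
  ereal_inf [set (\int[pi]_z (dist z.1 z.2)%:E)%E |
              pi in [set pi : probability (T * T)%type R | coupling mu nu pi]].

End Defs.

(* Main.v *)
Require Import Defs.
From HB Require Import structures.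
From mathcomp Require Import all_boot all_order all_algebra perm.
From mathcomp Require Import all_classical all_reals all_analysis measurable_realfun.
From mathcomp Require Import ring lra.
Import Order.TTheory GRing.Theory Num.Theory.
Import numFieldNormedType.Exports.
Local Open Scope classical_set_scope.
Local Open Scope ring_scope.

(* By Kantorovich duality it suffices to contract the Lipschitz constant of
   [iter n P phi] for 1-Lipschitz [phi].  The eigenfunction equation forces [ln h]
   to be Lipschitz with a constant depending only on [theta] and Lip(A), so the
   weights of P at two points at distance t, matched by the ICS bijection, compare
   up to a factor [expR (K * t)].  Hence the laws P(x,.) and P(y,.) can be coupled
   so that with probability at least [expR (- K * t)] the distance shrinks by
   [theta], and otherwise it is at most D.  For this chain the concave function
   [1 - expR (- a * t)] with [a = K / (1 - theta)] contracts in mean, and on [0, D]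
   it is comparable to t.

   The duality is obtained by cutting the space into finitely many small Borel
   cells: Farkas' lemma gives an optimal plan between the cell masses, which is
   spread inside the products of cells by the product measure.  This needs no
   measurable selection of the ICS bijections. *)

(** * Farkas' lemma for finitely many linear forms on an arbitrary vector space *)

Section Farkas.
Variables (R : realFieldType) (X : lmodType R).

(* Bartl's induction on the number of forms: if some [x0] satisfies all constraints
   but the last and violates the conclusion, the other forms are composed with the
   projection along [x0] onto the kernel of the last one. *)
Lemma farkas_ord (m : nat) (al : 'I_m -> X -> R) (ga : X -> R) :
  (forall i, scalar (al i)) -> scalar ga ->
  (forall x, (forall i, al i x <= 0) -> ga x <= 0) ->
  exists2 l : 'I_m -> R, (forall i, 0 <= l i) &
    forall x, ga x = \sum_(i < m) l i * al i x.
Proof.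
elim: m al ga => [|m IH] al ga lal lga H.
  exists (fun=> 0) => // x; rewrite big_ord0; apply/eqP; rewrite eq_le.
  have g0 : ga 0 = 0 by have := lga 1 0 0; rewrite scaler0 addr0; lra.
  have gN : ga (- x) = - ga x.
    by have := lga (-1) x 0; rewrite scaleN1r addr0 g0; lra.
  rewrite H /=; last by case.
  by have := H (- x); rewrite gN oppr_le0; apply; case.
pose al' i := al (lift ord_max i); pose be := al ord_max.
have [H'|] := pselect (forall x, (forall i, al' i x <= 0) -> ga x <= 0).
  have [l l0 lE] := IH al' ga (fun=> lal _) lga H'.
  exists (fun i => if unlift ord_max i is Some j then l j else 0).
    by move=> i; case: unliftP.
  move=> x; rewrite big_ord_recr /= unlift_none mul0r addr0 lE.
  apply: eq_bigr => i _.
  have -> : widen_ord (leqnSn m) i = lift ord_max i.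
    by apply/val_inj; rewrite /= /bump leqNgt ltn_ord.
  by rewrite liftK.
move=> /existsNP[x1 /not_implyP[x1a /negP]]; rewrite -ltNge => x1g.
have bx1 : 0 < be x1.
  rewrite ltNge; apply/negP => bx1; move: x1g; rewrite ltNge H// => i.
  by case: (unliftP ord_max i) => [j|] ->; [exact: x1a|exact: bx1].
have sc (f : X -> R) c u : scalar f -> f (c *: u) = c * f u.
  move=> lf; have f0 : f 0 = 0 by have := lf 1 0 0; rewrite scaler0 addr0; lra.
  by have := lf c u 0; rewrite addr0 f0 addr0.
have bi0 : 0 < (be x1)^-1 by rewrite invr_gt0.
pose x0 := (be x1)^-1 *: x1.
have x0a i : al' i x0 <= 0 by rewrite sc; [rewrite pmulr_rle0|exact: lal].
have x0g : 0 < ga x0 by rewrite sc// mulr_gt0.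
have x0b : be x0 = 1 by rewrite sc; [rewrite mulVf ?gt_eqF|exact: lal].
have pr (f : X -> R) x : scalar f -> f (x - be x *: x0) = f x - f x0 * be x.
  by move=> lf; rewrite addrC -scaleNr lf; ring.
pose ar i x := al' i x - al' i x0 * be x.
pose gr x := ga x - ga x0 * be x.
have lar i : scalar (ar i).
  by move=> c u v; rewrite /ar /al' /be !lal; ring.
have lgr : scalar gr by move=> c u v; rewrite /gr /be !lal lga; ring.
have [|l l0 lE] := IH ar gr lar lgr.
  move=> x xa; rewrite /gr -pr//; apply: H => i.
  case: (unliftP ord_max i) => [j|] ->; last first.
    by rewrite pr; [rewrite -/be x0b mul1r subrr|exact: lal].
  by rewrite pr; [exact: xa|exact: lal].
(* The last multiplier is the coefficient of [be] once the projection is expanded. It is nonnegative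
   because [ga x0 > 0] while every [al' j x0 <= 0]. *)
exists (fun i => if unlift ord_max i is Some j then l j
  else ga x0 - \sum_(j < m) l j * al' j x0).
  move=> i; case: unliftP => [j _|_]; first exact: l0.
  rewrite subr_ge0 (le_trans _ (ltW x0g))// sumr_le0// => j _.
  by rewrite mulr_ge0_le0.
move=> x; rewrite big_ord_recr /= unlift_none -/be.
have -> : ga x = gr x + ga x0 * be x by rewrite /gr subrK.
rewrite lE mulrBl [LHS]addrC [RHS]addrCA; congr (_ + _).
rewrite mulr_suml -sumrB; apply: eq_bigr => i _.
have -> : widen_ord (leqnSn m) i = lift ord_max i.
  by apply/val_inj; rewrite /= /bump leqNgt ltn_ord.
by rewrite liftK /ar /al'; ring.
Qed.

Lemma farkas (I : finType) (al : I -> X -> R) (ga : X -> R) :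
  (forall i, scalar (al i)) -> scalar ga ->
  (forall x, (forall i, al i x <= 0) -> ga x <= 0) ->
  exists2 l : I -> R, (forall i, 0 <= l i) &
    forall x, ga x = \sum_i l i * al i x.
Proof.
move=> lal lga H.
have [x Hx|l l0 lE] := farkas_ord #|I| (fun i => al (enum_val i)) ga
  (fun=> lal _) lga.
  by apply: H => i; have := Hx (enum_rank i); rewrite enum_rankK.
exists (fun i => l (enum_rank i)) => // x.
rewrite lE (reindex (@enum_rank I)) /=.
  by apply: eq_bigr => i _; rewrite enum_rankK.
by exists enum_val => i _; rewrite ?enum_rankK ?enum_valK.
Qed.

End Farkas.

(** * Kantorovich duality between finitely supported measures *)

Section FiniteKantorovich.
Variables (R : realType) (T : Type) (dist : T -> T -> R).
Hypothesis dist_metric : is_metric dist.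

(** The c-transform of [v]: a minimum of finitely many 1-Lipschitz functions. It turns a feasible
    pair of dual variables into a single 1-Lipschitz potential. *)
Lemma min_lipschitz (n : nat) (z : 'I_n.+1 -> T) (v : 'I_n.+1 -> R) :
  exists phi : T -> R, [/\ forall x y, `|phi x - phi y| <= dist x y,
    forall x j, phi x <= dist x (z j) - v j &
    forall x, exists j, phi x = dist x (z j) - v j].
Proof.
have [_ [_ [dC dT]]] := dist_metric.
pose J x := [arg min_(j < ord0) (dist x (z j) - v j)]%O.
pose phi x := dist x (z (J x)) - v (J x).
have phi_le x j : phi x <= dist x (z j) - v j.
  by rewrite /phi /J; case: arg_minP => // i _; exact.
exists phi; split => // [x y|x]; last by exists (J x).
have H a b : phi a - phi b <= dist a b.
  rewrite lerBlDr (le_trans (phi_le a (J b)))// addrA lerD2r; exact: dT.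
by rewrite ler_norml lerNl opprB H dC H.
Qed.

(** Farkas' lemma on triples (u, v, t), where t homogenizes the dual problem: the constraints are
    u_i + v_j <= t d(z_i, z_j) and t >= 0. The multipliers of the former are the transport plan,
    that of the latter is the slack in the cost. *)
Lemma finite_kantorovich (n : nat) (z : 'I_n.+1 -> T) (a b : 'I_n.+1 -> R) (W : R) :
  (forall i, 0 <= a i) -> (forall i, 0 <= b i) ->
  \sum_i a i = 1 -> \sum_i b i = 1 ->
  (forall phi : T -> R, (forall x y, `|phi x - phi y| <= dist x y) ->
    \sum_i a i * phi (z i) - \sum_i b i * phi (z i) <= W) ->
  exists g : 'I_n.+1 -> 'I_n.+1 -> R,
    [/\ forall i j, 0 <= g i j,
        forall i, \sum_j g i j = a i,
        forall j, \sum_i g i j = b j &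
        \sum_i \sum_j g i j * dist (z i) (z j) <= W].
Proof.
move=> a0 b0 a1 b1 H.
have [_ [d0 _]] := dist_metric.
pose X := ('rV[R]_n.+1 * 'rV[R]_n.+1 * R^o)%type.
pose al (o : option ('I_n.+1 * 'I_n.+1)) (x : X) : R :=
  if o is Some (i, j) then x.1.1 ord0 i + x.1.2 ord0 j - x.2 * dist (z i) (z j)
  else - x.2.
pose ga (x : X) : R := \sum_i a i * x.1.1 ord0 i + \sum_j b j * x.1.2 ord0 j
   - x.2 * W.
have sclr (u v : 'rV[R]_n.+1) c i : (c *: u + v) ord0 i = c * u ord0 i + v ord0 i.
  by rewrite !mxE.
have lal o : scalar (al o).
  move=> c u v; case: o => [[i j]|] /=; rewrite /al /= ?sclr /GRing.scale /=; ring.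
have lga : scalar ga.
  move=> c u v; rewrite /ga /=.
  under eq_bigr do rewrite sclr mulrDr mulrCA.
  under [X in _ + X - _ = _]eq_bigr do rewrite sclr mulrDr mulrCA.
  rewrite !big_split /= -!mulr_sumr /GRing.scale /=; ring.
have [x Hx|l l0 lE] := farkas _ _ _ _ _ lal lga.
  have : 0 <= x.2 by have := Hx None; rewrite /al oppr_le0.
  rewrite le_eqVlt => /orP[/eqP t0|t0].
    (* For t = 0, [ga x] is the average of u_i + v_j <= 0 under the product weights, since [a] and
       [b] have mass 1. *)
    rewrite /ga -t0 mul0r subr0.
    have -> : \sum_i a i * x.1.1 ord0 i + \sum_j b j * x.1.2 ord0 j =
      \sum_i \sum_j a i * b j * (x.1.1 ord0 i + x.1.2 ord0 j).
      rewrite -[X in X + _]mulr1 -b1 -[X in _ + X]mul1r -a1 !mulr_suml -big_split /=.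
      apply: eq_bigr => i _; rewrite !mulr_sumr -big_split /=.
      by apply: eq_bigr => j _; ring.
    apply: sumr_le0 => i _; apply: sumr_le0 => j _; rewrite mulr_ge0_le0 ?mulr_ge0//.
    by have := Hx (Some (i, j)); rewrite /al -t0 mul0r subr0.
  (* For t > 0, the c-transform of v / t dominates u / t and its opposite dominates v / t at the
     points [z i], so the hypothesis on [phi] bounds [ga x]. *)
  have [phi [phi1 phi2 phi3]] := min_lipschitz n z (fun j => x.1.2 ord0 j / x.2).
  have uphi i : x.1.1 ord0 i <= x.2 * phi (z i).
    have [j ->] := phi3 (z i); rewrite mulrBr mulrCA mulfV ?gt_eqF// mulr1.
    by have := Hx (Some (i, j)); rewrite /al; lra.
  have vphi i : x.1.2 ord0 i <= - (x.2 * phi (z i)).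
    have := phi2 (z i) i; rewrite (d0 _ _).2// sub0r -(ler_pM2l t0).
    by rewrite mulrN mulrCA mulfV ?gt_eqF// mulr1 lerNr.
  have := H phi phi1; rewrite -(ler_pM2l t0) => Hphi.
  rewrite /ga subr_le0 (le_trans _ Hphi)// mulrBr lerD//.
    by rewrite mulr_sumr ler_sum// => i _; rewrite mulrCA ler_wpM2l.
  rewrite mulr_sumr -sumrN ler_sum// => i _.
  by rewrite mulrCA -mulrN ler_wpM2l.
(* Evaluating the Farkas identity at basis vectors of u, of v and of t gives the row sums, the
   column sums and the cost. *)
pose e i : 'rV[R]_n.+1 := delta_mx ord0 i.
have eE i j : e i ord0 j = (j == i)%:R by rewrite mxE eqxx.
have bigo (G : option ('I_n.+1 * 'I_n.+1) -> R) :
  \sum_o G o = G None + \sum_i \sum_j G (Some (i, j)).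
  rewrite pair_big /= (bigD1 None)//=; congr (_ + _).
  rewrite (reindex_omap Some id) => [|[p|]]//=.
  by apply: eq_big => [p|[i j]//]; rewrite eqxx.
have delta (f : 'I_n.+1 -> R) i : \sum_j f j * (j == i)%:R = f i.
  rewrite (bigD1 i)//= eqxx mulr1 big1 ?addr0// => j /negPf ->.
  by rewrite mulr0.
exists (fun i j => l (Some (i, j))); split => // [i|j|].
- have := lE ((e i, 0), 0); rewrite bigo /ga /al /=.
  under eq_bigr do rewrite eE.
  under [X in _ + X - _ = _]eq_bigr do rewrite mxE mulr0.
  rewrite delta big1// mul0r subr0 addr0 oppr0 mulr0 add0r => ->.
  under [RHS]eq_bigr do under eq_bigr do rewrite eE mxE mul0r subr0 addr0.
  under [RHS]eq_bigr do rewrite -mulr_suml.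
  by rewrite delta.
- have := lE ((0, e j), 0); rewrite bigo /ga /al /=.
  under [X in X + _ - _ = _]eq_bigr do rewrite mxE mulr0.
  under [X in _ + X - _ = _]eq_bigr do rewrite eE.
  rewrite delta big1// mul0r subr0 add0r oppr0 mulr0 add0r => ->.
  apply: eq_bigr => i _.
  by under [RHS]eq_bigr do rewrite eE mxE mul0r subr0 add0r; rewrite delta.
- have := lE ((0, 0), 1); rewrite bigo /ga /al /=.
  under [X in X + _ - _ = _]eq_bigr do rewrite mxE mulr0.
  under [X in _ + X - _ = _]eq_bigr do rewrite mxE mulr0.
  under [X in _ = _ + X]eq_bigr do under eq_bigr do
     rewrite !mxE addr0 add0r mul1r mulrN.
  under [X in _ = _ + X]eq_bigr do rewrite sumrN.
  rewrite sumrN !big1_eq addr0 add0r mul1r mulrN1.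
  by have := l0 None; lra.
Qed.

End FiniteKantorovich.

(** Split [p] into [kap * q] and a remainder of mass [1 - kap]. The first part is paired with [q]
    index by index; the remainder is compared with the [q]-mean of [v]. *)
Lemma sum_mixture_le (R : realFieldType) (k : nat) (p q u v : 'I_k -> R)
    (kap c1 c2 : R) :
  \sum_i p i = 1 -> \sum_i q i = 1 -> (forall i, 0 <= q i) -> 0 <= kap ->
  (forall i, kap * q i <= p i) ->
  (forall i, u i - v i <= c1) -> (forall i j, u i - v j <= c2) ->
  \sum_i p i * u i - \sum_i q i * v i <= kap * c1 + (1 - kap) * c2.
Proof.
move=> p1 q1 q0 kap0 kqp uv1 uv2.
pose c := \sum_j q j * v j.
have uc i : u i - c <= c2.
  rewrite -[u i]mul1r -[c2]mul1r -q1 !mulr_suml -sumrB ler_sum// => j _.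
  by rewrite -mulrBr ler_wpM2l.
have -> : \sum_i p i * u i - c =
    kap * (\sum_i q i * (u i - v i)) + \sum_i (p i - kap * q i) * (u i - c).
  have -> : \sum_i (p i - kap * q i) * (u i - c) =
      (\sum_i p i * u i - \sum_i p i * c) -
      kap * (\sum_i q i * u i - \sum_i q i * c).
    by rewrite mulrBr !mulr_sumr -!sumrB; apply: eq_bigr => i _; ring.
  have -> : \sum_i q i * (u i - v i) = \sum_i q i * u i - c.
    by rewrite -sumrB; apply: eq_bigr => i _; rewrite mulrBr.
  by rewrite -!mulr_suml p1 q1; ring.
rewrite lerD//.
  rewrite ler_wpM2l// -[leRHS]mul1r -q1 mulr_suml ler_sum// => i _.
  by rewrite ler_wpM2l.
have -> : 1 - kap = \sum_i (p i - kap * q i) by rewrite sumrB p1 -mulr_sumr q1 mulr1.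
by rewrite mulr_suml ler_sum// => i _; rewrite ler_wpM2l// subr_ge0.
Qed.

(** * The concave function of the distance that contracts in mean *)

Section Profile.
Variables (R : realType) (theta K D : R).
Hypotheses (theta01 : 0 < theta < 1) (K0 : 0 < K) (D0 : 0 <= D).

(** Sum of the geometric series of terms K theta^j, so that [expR (- (rate * t))] is the product of
    the one-step factors exp(- K theta^j t). *)
Definition rate : R := K / (1 - theta).

Definition profile (t : R) : R := 1 - expR (- (rate * t)).

Definition gap : R := 1 - (1 - theta) * expR (- (rate * D)).

Lemma rate_gt0 : 0 < rate.
Proof. by move: theta01 => /andP[_ ?]; rewrite divr_gt0// subr_gt0. Qed.

Lemma gap01 : 0 < gap < 1.
Proof.
move: theta01 => /andP[t0 t1]; have tt : 0 < 1 - theta by rewrite subr_gt0.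
have e0 := expR_gt0 (- (rate * D)).
have e1 : expR (- (rate * D)) <= 1.
  by rewrite -expR0 ler_expR oppr_le0 mulr_ge0// ltW// rate_gt0.
by rewrite /gap; apply/andP; split; nra.
Qed.

Lemma profile_le (s t : R) : s <= t -> profile s <= profile t.
Proof.
by move=> st; rewrite lerD2l lerN2 ler_expR lerN2 ler_wpM2l// ltW// rate_gt0.
Qed.

Lemma profile_le_linear (t : R) : profile t <= rate * t.
Proof. by have := expR_ge1Dx (- (rate * t)); rewrite /profile; lra. Qed.

(** By concavity the slope of [profile] on [0, D] is least at [D], where it is
    [rate * expR (- (rate * D))]. The proof only uses exp(s) >= 1 + s, after factoring
    [expR (rate * D)]. *)
Lemma le_profile (t : R) : 0 <= t <= D ->
  t <= expR (rate * D) / rate * profile t.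
Proof.
move=> /andP[t0 tD]; have r0 := rate_gt0.
rewrite mulrAC ler_pdivlMr//.
have -> : expR (rate * D) = expR (rate * (D - t)) * expR (rate * t).
  by rewrite -expRD; congr expR; ring.
rewrite -mulrA /profile [expR (rate * t) * _]mulrBr mulr1 expRxMexpNx_1.
have h1 := expR_ge1Dx (rate * t).
have h2 : 1 <= expR (rate * (D - t)).
  by rewrite -expR0 ler_expR mulr_ge0 ?subr_ge0// ltW.
have h3 : 0 <= t * rate by rewrite mulr_ge0// ltW.
nra.
Qed.

(* [expR (- (rate * t))] is the probability that the distance contracts at every
   step, which makes [profile] harmonic for the coupled chain up to its value at
   [D]; the deficit [1 - profile D] at restarts is the gain. *)
Lemma profile_contract (t : R) : 0 <= t ->
  expR (- (K * t)) * profile (theta * t) + (1 - expR (- (K * t))) * profile D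
    <= gap * profile t.
Proof.
move=> t0; move: theta01 => /andP[th0 th1].
have rK : rate * (1 - theta) = K by rewrite /rate divfK// gt_eqF// subr_gt0.
have e1 : expR (- (K * t)) * expR (- (rate * (theta * t))) = expR (- (rate * t)).
  by rewrite -expRD -rK; congr expR; ring.
(* Convexity of exp between 0 and [- (rate * t)], as [K * t] is [(1 - theta) * (rate * t)]; it is
   derived from two tangent inequalities. *)
have conv : expR (- (K * t)) <= theta + (1 - theta) * expR (- (rate * t)).
  have a1 := expR_ge1Dx (K * t); have a2 := expR_ge1Dx (- (rate * t) + K * t).
  have E0 := expR_gt0 (- (K * t)).
  have f1 : expR (- (K * t)) * expR (K * t) = 1 by rewrite mulrC expRxMexpNx_1.
  have f2 : expR (- (rate * t)) = expR (- (K * t)) * expR (- (rate * t) + K * t).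
    by rewrite -expRD; congr expR; ring.
  have : expR (- (K * t)) * (theta * (1 + K * t) +
       (1 - theta) * (1 + (- (rate * t) + K * t))) <=
     expR (- (K * t)) * (theta * expR (K * t) +
       (1 - theta) * expR (- (rate * t) + K * t)).
    rewrite (ler_pM2l E0) lerD// ler_wpM2l//; lra.
  rewrite [X in _ <= X]mulrDr mulrCA f1 mulr1 mulrCA -f2; apply: le_trans.
  rewrite -[leLHS]mulr1 (ler_pM2l E0) -rK.
  by rewrite le_eqVlt; apply/orP; left; apply/eqP; ring.
have q0 := expR_gt0 (- (rate * D)).
(* By [e1] the left side equals [profile t - expR (- (rate * D)) * (1 - expR (- (K * t)))], and
   [conv] bounds the last factor below by [(1 - theta) * profile t]. *)
rewrite /profile /gap mulrBr mulr1 e1.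
nra.
Qed.

End Profile.

(** * Explicit constants in theta and Lip(A) *)

Section Constants.
Variables (R : realType) (theta LA : R).
Hypotheses (theta01 : 0 < theta < 1) (LA0 : 0 <= LA).

(** The fixed point of [l |-> theta * (LA + l)] plus a margin of 1, which finitely many iterations
    reach and which keeps the constant positive when [LA] is 0. *)
Definition log_lip_const : R := theta * LA / (1 - theta) + 1.

(** The first term comes from the numerators of the weights, taken at points of [F x] and [F y], the
    second from the denominators [h x] and [h y]. *)
Definition weight_ratio : R := theta * (LA + log_lip_const) + log_lip_const.

Lemma log_lip_const_gt0 : 0 < log_lip_const.
Proof.
move: theta01 => /andP[th0 th1].
by rewrite ltr_wpDl// divr_ge0 ?mulr_ge0 ?subr_ge0// ltW.
Qed.

Lemma weight_ratio_gt0 : 0 < weight_ratio.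
Proof.
move: theta01 => /andP[th0 th1]; have c0 := log_lip_const_gt0.
by apply: ltr_wpDl => //; exact: mulr_ge0 (ltW th0) (addr_ge0 LA0 (ltW c0)).
Qed.

End Constants.

(** * Regularity of the eigenfunction and contraction by the normalized operator *)

Section Contraction.
Variables (R : realType) (T : Type) (dist : T -> T -> R) (k : nat).
Variables (F : T -> 'I_k -> T) (A h : T -> R) (rho theta LA D : R).
Hypothesis dist_metric : is_metric dist.
Hypothesis ICS : is_ICS dist F theta.
Hypothesis LA0 : 0 <= LA.
Hypothesis A_lip : forall x y, `|A x - A y| <= LA * dist x y.
Hypothesis dist_le : forall x y, dist x y <= D.
Hypothesis rho0 : 0 < rho.
Hypothesis h0 : forall x, 0 < h x.
Hypothesis h_eigen : forall x, transfer F A h x = rho * h x.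

Let d0 x y : 0 <= dist x y. Proof. by have [] := dist_metric. Qed.
Let dC x y : dist x y = dist y x. Proof. by have [_ [_ []]] := dist_metric. Qed.
Let th0 : 0 < theta. Proof. by have [/andP[]] := ICS. Qed.
Let th1 : theta < 1. Proof. by have [/andP[]] := ICS. Qed.
Let thb : 0 < theta < 1. Proof. by have [] := ICS. Qed.

Local Notation log_lip_const := (log_lip_const R theta LA).
Local Notation weight_ratio := (weight_ratio R theta LA).

Definition log_lip (l : R) := forall x y, h x <= h y * expR (l * dist x y).

Lemma weight_le (l : R) x y t : 0 <= l -> log_lip l -> dist x y <= t ->
  expR (A x) * h x <= expR (A y) * h y * expR ((LA + l) * t).
Proof.
move=> l0 hl xyt.
have hxy : h x <= h y * expR (l * t).
  by rewrite (le_trans (hl x y))// ler_pM2l// ler_expR ler_wpM2l.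
have Axy : expR (A x) <= expR (A y) * expR (LA * t).
  rewrite -expRD ler_expR -lerBlDl (le_trans (ler_norm _))//.
  by rewrite (le_trans (A_lip _ _))// ler_wpM2l.
rewrite (le_trans (ler_pM _ _ Axy hxy)) ?expR_ge0 ?(ltW (h0 _))//.
by rewrite mulrACA -expRD -mulrDl.
Qed.

(** Match the terms of the eigenfunction equation at [x] and [y] by the ICS permutation: the matched
    points are [theta] times closer, and the resulting factor is common to all terms. *)
Lemma log_lip_step (l : R) : 0 <= l -> log_lip l -> log_lip (theta * (LA + l)).
Proof.
move=> l0 hl x y; have [_ /(_ x y)[s hs]] := ICS.
rewrite -(ler_pM2l rho0) mulrA -!h_eigen /transfer.
rewrite [X in _ <= X * _](reindex_perm s) mulr_suml ler_sum// => i _.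
rewrite (le_trans (weight_le _ _ _ _ l0 hl (hs i)))//.
by rewrite mulrCA mulrA.
Qed.

(* The iterates of [l |-> theta * (LA + l)] converge to
   [theta * LA / (1 - theta)], whatever the initial constant is. *)
Lemma log_lip_eigenfunction (l : R) : 0 <= l -> log_lip l -> log_lip log_lip_const.
Proof.
move=> l0 hl; pose c := theta * LA / (1 - theta).
have c0 : 0 <= c by rewrite divr_ge0 ?mulr_ge0 ?subr_ge0// ltW.
have cE : theta * (LA + c) = c.
  by rewrite /c; field; rewrite gt_eqF// subr_gt0.
have H n : log_lip (c + theta ^+ n * l).
  elim: n => [|n IH].
    rewrite expr0 mul1r => x y; rewrite (le_trans (hl x y))// ler_pM2l// ler_expR.
    by rewrite ler_wpM2r// lerDr.
  have := log_lip_step _ _ IH; rewrite addrA mulrDr cE exprS mulrA; apply.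
  by rewrite addr_ge0// mulr_ge0 ?exprn_ge0// ltW.
have : (fun n : nat => theta ^+ n) @ \oo --> (0 : R).
  by apply: cvg_expr; rewrite gtr0_norm.
(* Once [theta ^+ N] is below this threshold, [theta ^+ N * l] is at most the margin 1. *)
have l1 : 0 < (l + 1)^-1 by rewrite invr_gt0 ltr_wpDl.
move=> /cvgr0Pnorm_lt /(_ _ l1)[N _ /(_ N)/= /(_ (leqnn _))].
rewrite ger0_norm ?exprn_ge0 ?ltW// => /ltW.
rewrite -(ler_pM2r (ltr_wpDl l0 ltr01 : 0 < l + 1)) mulVf; last first.
  by rewrite gt_eqF// ltr_wpDl.
move=> tN x y; rewrite (le_trans (H N x y))// ler_pM2l// ler_expR ler_wpM2r//.
have := exprn_ge0 N (ltW th0); rewrite -[log_lip_const]/(c + 1); lra.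
Qed.

Definition weight x i := expR (A (F x i)) * h (F x i) / (rho * h x).

Lemma normalizedE phi x :
  normalized F A h rho phi x = \sum_i weight x i * phi (F x i).
Proof.
rewrite /normalized /transfer mulr_suml; apply: eq_bigr => i _.
by rewrite /weight; ring.
Qed.

Lemma weight_ge0 x i : 0 <= weight x i.
Proof. by rewrite divr_ge0 ?mulr_ge0 ?expR_ge0 ?ltW. Qed.

Lemma weight_sum x : \sum_i weight x i = 1.
Proof.
rewrite -mulr_suml; have := h_eigen x; rewrite /transfer => ->.
by rewrite divff// mulf_neq0 ?gt_eqF.
Qed.

Hypothesis h_log_lip : log_lip log_lip_const.

(** Numerators are compared at distance [theta * t], denominators at distance [t], and [rho]
    cancels. *)
Lemma weight_comparison x y i j : dist (F x i) (F y j) <= theta * dist x y ->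
  expR (- (weight_ratio * dist x y)) * weight y j <= weight x i.
Proof.
move=> dij; set t := dist x y in dij *.
have c0 := ltW (log_lip_const_gt0 _ _ _ thb LA0).
have := weight_le _ (F y j) (F x i) _ c0 h_log_lip.
move=> /(_ (theta * t)); rewrite dC => /(_ dij) w1.
have w2 := h_log_lip x y; rewrite -/t in w2.
have -> : expR (- (weight_ratio * t)) = expR (- ((LA + log_lip_const) * (theta * t)))
    * expR (- (log_lip_const * t)).
  by rewrite -expRD -[weight_ratio]/(_ + _); congr expR; ring.
set a := expR (A (F y j)) * h (F y j) in w1.
set b := expR (A (F x i)) * h (F x i) in w1.
rewrite /weight -/a -/b.
set E1 := expR (- _); set E2 := expR (- _).
have E10 : 0 < E1 := expR_gt0 _.
have E20 : 0 < E2 := expR_gt0 _.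
rewrite ler_pdivlMr ?mulr_gt0// mulrA mulrAC ler_pdivrMr ?mulr_gt0//.
have w1' : E1 * a <= b.
  rewrite mulrC -ler_pdivlMr// /E1 expRN invrK; exact: w1.
have w2' : E2 * h x <= h y.
  rewrite mulrC -ler_pdivlMr// /E2 expRN invrK; exact: w2.
have a0 : 0 <= E1 * a by rewrite !mulr_ge0 ?expR_ge0 ?ltW.
have e0 : 0 <= E2 * h x by rewrite mulr_ge0 ?ltW.
have := ler_pM a0 e0 w1' w2'; rewrite -(ler_pM2l rho0).
by congr (_ <= _); ring.
Qed.

Let V := profile R theta weight_ratio.
Let lam := gap R theta weight_ratio D.

Let D0 (x : T) : 0 <= D. Proof. exact: le_trans (d0 x x) (dist_le _ _). Qed.

(** One step of the coupled chain: after reindexing by the ICS permutation, [sum_mixture_le] charges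
    paired points [N * V (theta * t)] and all others [N * V D], and [profile_contract] sums up. *)
Lemma normalized_contract (N : R) (phi : T -> R) : 0 <= N ->
  (forall x y, phi x - phi y <= N * V (dist x y)) ->
  forall x y, normalized F A h rho phi x - normalized F A h rho phi y
    <= lam * N * V (dist x y).
Proof.
move=> N0 Hphi x y; have K0 := weight_ratio_gt0 _ _ _ thb LA0.
have [_ /(_ x y)[s hs]] := ICS.
rewrite !normalizedE [X in _ - X](reindex_perm s) /=.
have := profile_contract R theta weight_ratio D thb _ (d0 x y).
rewrite -/V -/lam => c.
rewrite (_ : lam * N * _ = N * (lam * V (dist x y))); last ring.
apply: le_trans (ler_wpM2l N0 c); rewrite mulrDr !(mulrCA N).
apply: sum_mixture_le.
- exact: weight_sum.
- by have := weight_sum y; rewrite (reindex_perm s).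
- by move=> i; exact: weight_ge0.
- exact: expR_ge0.
- by move=> i; apply: weight_comparison.
- move=> i; rewrite (le_trans (Hphi _ _))// ler_wpM2l//.
  by apply: profile_le.
- move=> i j; rewrite (le_trans (Hphi _ _))// ler_wpM2l//.
  by apply: profile_le.
Qed.

(** Pass from the distance to [V] by [le_profile], iterate, and return by [profile_le_linear]. The
    two comparisons cost [expR (r * D) / r] and [r], whence the constant. *)
Lemma iter_normalized_contract (phi : T -> R) (n : nat) :
  (forall x y, `|phi x - phi y| <= dist x y) ->
  forall x y, iter n (normalized F A h rho) phi x -
    iter n (normalized F A h rho) phi y <=
    expR (rate R theta weight_ratio * D) * lam ^+ n * dist x y.
Proof.
move=> Hphi; set r := rate _ _ _.
have K0 := weight_ratio_gt0 _ _ _ thb LA0.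
have r0 : 0 < r := rate_gt0 _ _ _ thb K0.
have c0 (x : T) m : 0 <= lam ^+ m * (expR (r * D) / r).
  have /andP[lam0 _] := gap01 R theta weight_ratio D thb K0 (D0 x).
  exact: mulr_ge0 (exprn_ge0 _ (ltW lam0)) (divr_ge0 (expR_ge0 _) (ltW r0)).
have H m x y : iter m (normalized F A h rho) phi x -
    iter m (normalized F A h rho) phi y <=
    lam ^+ m * (expR (r * D) / r) * V (dist x y).
  elim: m x y => [|m IH] x y.
    rewrite expr0 mul1r (le_trans (ler_norm _))//= (le_trans (Hphi _ _))//.
    by apply: le_profile => //; rewrite d0 dist_le.
  by rewrite exprS -(mulrA lam); exact: normalized_contract (c0 x m) IH x y.
move=> x y; rewrite (le_trans (H n x y))//.
rewrite (le_trans (ler_wpM2l (c0 x n) (profile_le_linear R theta weight_ratio _)))// -/r.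
by rewrite le_eqVlt; apply/orP; left; apply/eqP; field; rewrite gt_eqF.
Qed.

End Contraction.

(** * Bounds from compactness and Lipschitz continuity *)

Section Bounds.
Context {R : realType} {T : Type}.
Variable dist : T -> T -> R.
Hypothesis dist_metric : is_metric dist.

Let d0 x y : 0 <= dist x y. Proof. by have [] := dist_metric. Qed.
Let dC x y : dist x y = dist y x. Proof. by have [_ [_ []]] := dist_metric. Qed.
Let dT x y z : dist x z <= dist x y + dist y z.
Proof. by have [_ [_ [_]]] := dist_metric. Qed.

(** The Lipschitz hypothesis bounds the set of slopes, which makes its [sup] a genuine upper
    bound. *)
Lemma lipconst_le (f : T -> R) : is_lipschitz dist f ->
  forall x y, `|f x - f y| <= lipconst dist f * dist x y.
Proof.
move=> [L fL] x y; have [_ [dE _]] := dist_metric.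
have dist_gt0 u v : u <> v -> 0 < dist u v.
  by move=> uv; rewrite lt_neqAle d0 andbT eq_sym; apply/eqP => /(dE u v).1.
have [<-|xy] := pselect (x = y); first by rewrite (dE x x).2// subrr normr0 mulr0.
rewrite -ler_pdivrMr ?dist_gt0//; apply: ub_le_sup; last by exists (x, y).
by exists L => _ [[u v] /= uv <-]; rewrite ler_pdivrMr ?dist_gt0.
Qed.

Lemma dopen_ball (z : T) (e : R) : dopen dist [set y | dist z y < e].
Proof.
move=> x /= zx; exists (e - dist z x) => [|y]; first by rewrite subr_gt0.
by rewrite ltrBrDl; exact: le_lt_trans.
Qed.

(** A finite subcover by open sets with a bound on each. It serves for the diameter and for a
    positive lower bound of [h]. *)
Lemma locally_bounded (f : T -> R) : dcompact dist ->
  (forall x, exists2 e : R, 0 < e & exists M, forall y, dist x y < e -> f y <= M) ->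
  exists M, forall x, f x <= M.
Proof.
move=> comp floc.
pose G := [set V | dopen dist V /\ exists M, forall y, V y -> f y <= M].
have [V []//||n [V [GV covV]]] := comp G.
  move=> x; have [e e0 eM] := floc x; exists [set y | dist x y < e]; last first.
    by have [_ [/(_ x x)[_ /(_ erefl) xx]]] := dist_metric; rewrite /= xx.
  by split; first exact: dopen_ball.
have [M VM] := choice (fun i => (GV i).2).
exists (\sum_i `|M i|) => x; have [i Vix] := covV x.
rewrite (le_trans (VM i x Vix))// (le_trans (ler_norm _))// (bigD1 i)//=.
by rewrite lerDl sumr_ge0.
Qed.

Lemma le_mdiam : dcompact dist -> forall x y, dist x y <= mdiam dist.
Proof.
move=> comp x0 y0.
have [x|M xM] := locally_bounded (dist x0) comp.
  exists 1 => //; exists (dist x0 x + 1) => y /ltW xy.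
  by rewrite (le_trans (dT _ x _))// lerD2l.
apply: ub_le_sup; last by exists (x0, y0).
exists (M + M) => _ [[x y] _ <-] /=; rewrite (le_trans (dT _ x0 _))// lerD//.
by rewrite dC.
Qed.

(** With 1/h <= M, one has h x <= h y + L d(x, y) <= h y (1 + L M d(x, y)). The constant depends on
    [h], but [log_lip_eigenfunction] replaces it by a uniform one. *)
Lemma positive_lipschitz_log_lip (h : T -> R) : dcompact dist ->
  is_lipschitz dist h -> (forall x, 0 < h x) ->
  exists2 l : R, 0 <= l & log_lip R T dist h l.
Proof.
move=> comp [L hL] h0.
have hL' x y : `|h x - h y| <= `|L| * dist x y.
  by rewrite (le_trans (hL x y))// ler_wpM2r// ler_norm.
have [x|M xM] := locally_bounded (fun x => (h x)^-1) comp.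
  have L0 : 0 < `|L| + 1 by rewrite ltr_wpDl.
  (* On this ball [h] varies by less than [h x / 2], so it stays above [h x / 2]. *)
  exists (h x / 2 / (`|L| + 1)); first by rewrite !divr_gt0.
  exists (h x / 2)^-1 => y; rewrite ltr_pdivlMr// => xy.
  rewrite lef_pV2 ?posrE ?divr_gt0//.
  have := le_trans (ler_norm _) (hL' x y); move: xy; rewrite mulrDr mulr1.
  by have := d0 x y; rewrite mulrC; lra.
exists (`|L| * `|M|); first by rewrite mulr_ge0.
move=> x y.
apply: (@le_trans _ _ (h y * (1 + `|L| * `|M| * dist x y))); last first.
  by rewrite ler_pM2l// expR_ge1Dx.
have hM : 1 <= h y * `|M|.
  by rewrite -(mulfV (lt0r_neq0 (h0 y))) ler_pM2l// (le_trans (xM y))// ler_norm.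
rewrite mulrDr mulr1 -lerBlDl (le_trans (ler_norm _))// (le_trans (hL' x y))//.
rewrite -[leLHS]mul1r [leRHS](_ : _ = (h y * `|M|) * (`|L| * dist x y)); last ring.
by rewrite ler_wpM2r// mulr_ge0.
Qed.

Lemma lipschitz_dcontinuous (f : T -> R) (L : R) :
  (forall x y, f x - f y <= L * dist x y) -> dcontinuous dist f.
Proof.
move=> fL x e e0; have L0 : 0 < `|L| + 1 by rewrite ltr_wpDl.
exists (e / (`|L| + 1)); first by rewrite divr_gt0.
move=> y; rewrite ltr_pdivlMr// => xy.
apply: le_lt_trans xy; rewrite mulrDr mulr1.
have le1 : L * dist x y <= `|L| * dist x y by rewrite ler_wpM2r// ler_norm.
have := fL x y; have := fL y x; rewrite dC.
have := d0 x y; rewrite ler_norml (mulrC (dist x y)) => *.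
by apply/andP; split; lra.
Qed.

End Bounds.


(** * Probabilities with density constant on the cells of a finite partition *)

Section MeasureProbability.
Context {R : realType} {d : measure_display} {U : measurableType d}.
Variables (m : {measure set U -> \bar R}) (m1 : m setT = 1%E).

(** The mass equation is an argument of this alias of [m] so that the probability structure can be
    attached to it. *)
Definition total_one_measure of m setT = 1%E : set U -> \bar R := m.

Local Notation mu := (total_one_measure m1).

HB.instance Definition _ := Measure.on mu.
HB.instance Definition _ := Measure_isProbability.Build _ _ _ mu m1.

Lemma measure_probability : exists P : probability U R, forall E, P E = m E.
Proof. by exists mu. Qed.

End MeasureProbability.

Section Cells.
Context {R : realType} {d : measure_display} {U : measurableType d} {I : finType}.
Variable c : U -> I.
Hypothesis mc : forall i, measurable (c @^-1` [set i]).

Lemma measurable_cells (f : I -> R) : measurable_fun setT (fun x => f (c x)).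
Proof.
move=> _ Y mY; rewrite setTI.
rewrite (_ : _ @^-1` _ = \bigcup_(i in [set i | Y (f i)]) (c @^-1` [set i])).
  by apply: fin_bigcup_measurable => //; exact: finite_finset.
by apply/seteqP; split => [x Yx|x [i Yi ci]]; [exists (c x)|rewrite /= ci].
Qed.

Lemma integral_cells (mu : {measure set U -> \bar R}) (f : I -> R) :
  (\int[mu]_x (f (c x))%:E = \sum_i (f i)%:E * mu (c @^-1` [set i]))%E.
Proof.
have covT : \big[setU/set0]_(i <- enum I) (c @^-1` [set i]) = setT.
  apply/seteqP; split => // x _; rewrite -bigcup_seq /=.
  by exists (c x) => //=; rewrite mem_enum.
have := @integral_bigsetU_EFin _ _ R mu I (fun i => c @^-1` [set i])
  (fun x => f (c x)) (enum I) mc (enum_uniq _).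
rewrite /= covT => ->.
- rewrite big_enum /=; apply: eq_bigr => i _.
  rewrite -integral_cst//; apply: eq_integral => x.
  by rewrite inE => /= ->.
- by move=> i j _ _ [x [/= <- <-]].
- by apply/measurable_EFinP; exact: measurable_cells.
Qed.

Lemma measure_cells (mu : {measure set U -> \bar R}) (B : set U) : measurable B ->
  (mu B = \sum_i mu (B `&` c @^-1` [set i]))%E.
Proof.
(* Additivity over the cells is the integral of the constant 1 against the restriction of [mu] to
   [B]. *)
move=> mB; have := integral_cells (mrestr mu mB) (fun=> 1).
rewrite integral_cst//= mul1e /mrestr setTI => ->.
by apply: eq_bigr => i _; rewrite mul1e setIC.
Qed.

Lemma cell_density (mu : {measure set U -> \bar R}) (w : I -> R) :
  (forall i, 0 <= w i) ->
  (\sum_i (w i)%:E * mu (c @^-1` [set i]) = 1)%E ->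
  exists P : probability U R, forall E, measurable E ->
    (P E = \sum_i (w i)%:E * mu (E `&` c @^-1` [set i]))%E.
Proof.
move=> w0 w1.
(* [msum] is indexed by naturals, so cells are numbered by [enum_rank]; other indices get the zero
   measure. *)
pose m_ (k : nat) : {measure set U -> \bar R} :=
  if [pick i | enum_rank i == k :> nat] is Some i then
    mscale (NngNum (w0 i)) (mrestr mu (mc i)) else mzero.
pose m : {measure set U -> \bar R} := msum m_ #|I|.
have mE E : (m E = \sum_i (w i)%:E * mu (E `&` c @^-1` [set i]))%E.
  rewrite /m /= /msum (reindex (@enum_rank I)) /=; last first.
    by exists enum_val => i _; rewrite ?enum_rankK ?enum_valK.
  apply: eq_bigr => i _; rewrite /m_; case: pickP => [j /eqP/val_inj/enum_rank_inj ->//|].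
  by move=> /(_ i); rewrite eqxx.
have m1 : m setT = 1%E.
  by rewrite mE -[RHS]w1; apply: eq_bigr => i _; rewrite setTI.
by have [P PE] := measure_probability m m1; exists P => E _; rewrite PE mE.
Qed.

End Cells.

Lemma probability_inhabited (R : realType) (d : measure_display)
    (U : measurableType d) (P : probability U R) : inhabited U.
Proof.
apply: contrapT => U0; have := probability_setT P.
rewrite (_ : setT = set0) ?measure0; last first.
  by apply/seteqP; split => // x; case: U0.
by move=> /eqP; rewrite eqe eq_sym oner_eq0.
Qed.

Lemma probability_integrable (R : realType) (d : measure_display)
    (U : measurableType d) (P : probability U R) (f : U -> R) (M : R) :
  measurable_fun setT f -> (forall x, `|f x| <= M) ->
  P.-integrable setT (EFin \o f).
Proof.
move=> mf fM; apply: measurable_bounded_integrable => //.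
  by rewrite -ge0_fin_numE ?fin_num_measure.
by exists M; split; [exact: num_real|move=> y My x _; exact: le_trans (fM x) (ltW My)].
Qed.

(** * Kantorovich duality on a compact metric space *)

Section CompactMetric.
Context {R : realType} {d : measure_display} {T : measurableType d}.
Variables (dist : T -> T -> R) (D : R).
Hypothesis dist_metric : is_metric dist.
Hypothesis dist_compact : dcompact dist.
Hypothesis borel : is_borel dist.
Hypothesis dist_le : forall x y, dist x y <= D.

Let d0 x y : 0 <= dist x y. Proof. by have [] := dist_metric. Qed.
Let dxx x : dist x x = 0. Proof. by have [_ [/(_ x x)[_ ->//]]] := dist_metric. Qed.
Let dC x y : dist x y = dist y x. Proof. by have [_ [_ []]] := dist_metric. Qed.
Let dT x y z : dist x z <= dist x y + dist y z.
Proof. by have [_ [_ [_]]] := dist_metric. Qed.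

Lemma dopen_measurable (V : set T) : dopen dist V -> measurable V.
Proof. by move=> oV; rewrite borel; exact: sub_gen_smallest. Qed.

Lemma dcontinuous_measurable (f : T -> R) :
  dcontinuous dist f -> measurable_fun setT f.
Proof.
move=> cf mD; apply: (measurability _ (RGenOInfty.measurableE R)) => //.
move=> /= _ [_ [a ->] <-]; rewrite setTI preimage_itvoy.
apply: dopen_measurable => x /= ax.
have [|e e0 He] := cf x (f x - a); first by rewrite subr_gt0.
by exists e => // y /He; rewrite ltr_norml => /andP[_]; lra.
Qed.

(** Take a finite cover by balls of radius [e] and send each point to the first ball containing it.
    The point [x0] rules out an empty cover. *)
Lemma cells_exist (x0 : T) (e : R) : 0 < e ->
  exists (n : nat) (z : 'I_n.+1 -> T) (c : T -> 'I_n.+1),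
    (forall i, measurable (c @^-1` [set i])) /\ forall x, dist x (z (c x)) <= e.
Proof.
move=> e0; pose G := [set V | exists z, V = [set y | dist z y < e]].
have [_ [z ->]||n [V [GV covV]]] := dist_compact G.
- exact: (dopen_ball _ dist_metric).
- by move=> x; exists [set y | dist x y < e]; [exists x|rewrite /= dxx].
have [z Vz] := choice GV.
case: n => [|n] in V GV covV z Vz *; first by have [[]] := covV x0.
have mV i : measurable (V i).
  by rewrite Vz; apply: dopen_measurable; exact: (dopen_ball _ dist_metric).
have H x : exists i, V i x /\ forall j : 'I_n.+1, (j < i)%N -> ~ V j x.
  have [i0 /asboolP Vi0] := covV x.
  case: (@arg_minnP _ i0 (fun i => `[< V i x >]) (fun i => nat_of_ord i) Vi0).
  move=> i /asboolP Vi imin; exists i; split => // j ji /asboolP /imin.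
  by rewrite leqNgt ji.
have [c Hc] := choice H.
exists n, z, c; split => [i|x]; last first.
  by have [+ _] := Hc x; rewrite Vz /= dC => /ltW.
rewrite (_ : _ @^-1` _ =
    V i `\` \bigcup_(j in [set j : 'I_n.+1 | (j < i)%N]) V j).
  by apply: measurableD => //; apply: fin_bigcup_measurable => //; exact: finite_finset.
apply/seteqP; split => [x <-|x [Vi nV]].
  by have [Vc nV] := Hc x; split => // -[j /= /nV].
have [Vc nVc] := Hc x; apply: val_inj => /=.
have [ci|ic|//] := ltngtP (c x) i; first by exfalso; apply: nV; exists (c x).
by have := nVc _ ic.
Qed.

Let cell2 {n} (c : T -> 'I_n.+1) (p : T * T) := (c p.1, c p.2).

Let measurable_cell2 n (c : T -> 'I_n.+1) :
  (forall i, measurable (c @^-1` [set i])) ->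
  forall p, measurable (cell2 c @^-1` [set p]).
Proof.
move=> mc [i j]; rewrite (_ : _ @^-1` _ = (c @^-1` [set i]) `*` (c @^-1` [set j])).
  exact: measurableX.
by apply/seteqP; split => -[x y] /= [<- <-].
Qed.

(** The product carries the product sigma-algebra, so measurability is obtained by writing [dist] as
    a limit of functions constant on products of cells. *)
Lemma measurable_dist : measurable_fun setT (fun p : T * T => dist p.1 p.2).
Proof.
have [[x0]|T0] := pselect (inhabited T); last first.
  move=> _ Y _; rewrite (_ : _ `&` _ = set0)//.
  by apply/seteqP; split => // -[x]; case: T0.
have H (k : nat) : exists f : T * T -> R, measurable_fun setT f /\
    forall p, `|dist p.1 p.2 - f p| <= 2 * k.+1%:R^-1.
  have k0 : 0 < k.+1%:R^-1 :> R by rewrite invr_gt0.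
  have [n [z [c [mc cz]]]] := cells_exist x0 _ k0.
  exists (fun p => dist (z (c p.1)) (z (c p.2))); split.
    exact: (measurable_cells _ (measurable_cell2 _ _ mc)
      (fun q => dist (z q.1) (z q.2))).
  move: cz; set q := _^-1 => cz [x y] /=; set u := z (c x); set v := z (c y).
  have := cz x; have := cz y; rewrite -/u -/v.
  have := dT x u y; have := dT u v y; have := dT u x v; have := dT x y v.
  rewrite (dC u x) (dC v y) ler_norml => *; apply/andP; split; lra.
have [f Hf] := choice H.
apply: (measurable_fun_cvg (h := f)) => [m|p _]; first by have [] := Hf m.
apply/cvgrPdist_le => e e0.
have e20 : 0 < e / 2 by rewrite divr_gt0.
near=> m; have [_ /(_ p)/le_trans] := Hf m; apply.
have : m.+1%:R^-1 < (PosNum e20)%:num by near: m; exact: near_infty_natSinv_lt.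
by move: (m.+1%:R^-1) => q /=; lra.
Unshelve. all: by end_near.
Qed.

Lemma dist_integrable (P : probability (T * T)%type R) :
  P.-integrable setT (EFin \o (fun p : T * T => dist p.1 p.2)).
Proof.
apply: (probability_integrable _ _ _ _ _ D); first exact: measurable_dist.
by move=> p; rewrite ger0_norm.
Qed.

Lemma lipschitz_bounded (f : T -> R) (L : R) :
  (forall x y, f x - f y <= L * dist x y) -> exists M, forall x, `|f x| <= M.
Proof.
move=> fL; have [[x0]|T0] := pselect (inhabited T); last first.
  by exists 0 => x; case: T0.
exists (`|f x0| + `|L| * D) => x.
rewrite -[f x](subrK (f x0)) addrC (le_trans (ler_normD _ _))// lerD2l.
have H a b : f a - f b <= `|L| * D.
  rewrite (le_trans (fL a b))// (le_trans (ler_norm _))// normrM ler_wpM2l//.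
  by rewrite ger0_norm.
by rewrite ler_norml lerNl opprB !H.
Qed.

Lemma lipschitz_measurable (f : T -> R) (L : R) :
  (forall x y, f x - f y <= L * dist x y) -> measurable_fun setT f.
Proof.
by move=> /(lipschitz_dcontinuous _ dist_metric); exact: dcontinuous_measurable.
Qed.

Lemma lipschitz_integrable (P : probability T R) (f : T -> R) (L : R) :
  (forall x y, f x - f y <= L * dist x y) -> P.-integrable setT (EFin \o f).
Proof.
move=> fL; have [M fM] := lipschitz_bounded f L fL.
by apply: (probability_integrable _ _ _ _ _ M) => //; exact: lipschitz_measurable fL.
Qed.

(** Discretization error: a 1-Lipschitz [phi] lies within [e] of its value at the centre of the
    cell. *)
Lemma Rintegral_cells (P : probability T R) n (z : 'I_n.+1 -> T) (c : T -> 'I_n.+1)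
    (e : R) (phi : T -> R) :
  (forall i, measurable (c @^-1` [set i])) -> (forall x, dist x (z (c x)) <= e) ->
  (forall x y, `|phi x - phi y| <= dist x y) ->
  `|\int[P]_x phi x - \sum_i fine (P (c @^-1` [set i])) * phi (z i)| <= e.
Proof.
move=> mc cz phi1.
have Pfin i : P (c @^-1` [set i]) \is a fin_num by rewrite fin_num_measure.
have E (f : 'I_n.+1 -> R) :
    \int[P]_x f (c x) = \sum_i fine (P (c @^-1` [set i])) * f i.
  rewrite /Rintegral (integral_cells _ mc).
  rewrite (eq_bigr (fun i => (fine (P (c @^-1` [set i])) * f i)%:E)) ?sumEFin//.
  by move=> i _; rewrite EFinM fineK// muleC.
have S1 : \sum_i fine (P (c @^-1` [set i])) = 1.
  have := E (fun=> 1); rewrite Rintegral_cst//= probability_setT/= mulr1 => ->.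
  by apply: eq_bigr => i _; rewrite mulr1.
have iphi : P.-integrable setT (EFin \o phi).
  by apply: (lipschitz_integrable _ _ 1) => x y; rewrite mul1r (le_trans (ler_norm _)).
have isimple (f : 'I_n.+1 -> R) : P.-integrable setT (EFin \o (fun x => f (c x))).
  apply: (probability_integrable _ _ _ _ _ (\sum_i `|f i|)).
    exact: measurable_cells.
  by move=> x; rewrite (bigD1 (c x))//= lerDl sumr_ge0.
have up : \int[P]_x phi x <= \int[P]_x (phi (z (c x)) + e).
  apply: le_Rintegral => //; first exact: (isimple (fun i => phi (z i) + e)).
  move=> x _; have := le_trans (ler_norm _) (le_trans (phi1 x (z (c x))) (cz x)); lra.
have lo : \int[P]_x (phi (z (c x)) - e) <= \int[P]_x phi x.
  apply: le_Rintegral => //; first exact: (isimple (fun i => phi (z i) - e)).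
  move=> x _; have := le_trans (ler_norm _) (le_trans (phi1 (z (c x)) x) _).
  by move=> /(_ e); rewrite dC => /(_ (cz x)); lra.
rewrite (E (fun i => phi (z i) + e)) in up; rewrite (E (fun i => phi (z i) - e)) in lo.
have S s : \sum_i fine (P (c @^-1` [set i])) * (phi (z i) + s) =
    \sum_i fine (P (c @^-1` [set i])) * phi (z i) + s.
  by under eq_bigr do rewrite mulrDr; rewrite big_split /= -mulr_suml S1 mul1r.
move: up lo; rewrite !S ler_norml => *.
by apply/andP; split; lra.
Qed.

(** The hard half of the duality. Since [W1] is an infimum, a coupling of cost at most [W + e] for
    each [e] is enough. *)
Lemma kantorovich_le (m m' : probability T R) (W : R) :
  (forall phi : T -> R, (forall x y, `|phi x - phi y| <= dist x y) ->
    \int[m]_x phi x - \int[m']_x phi x <= W) ->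
  (W1 dist m m' <= W%:E)%E.
Proof.
move=> HW; apply/lee_addgt0Pr => e e0.
have [x0] := probability_inhabited _ _ _ m.
(* Discretizing the two integrals costs [2 * ep], and replacing points by centres in the cost
   another [2 * ep]. *)
pose ep := e / 4; have ep0 : 0 < ep by rewrite divr_gt0.
have [n [z [c [mc cz]]]] := cells_exist x0 _ ep0.
pose a i := fine (m (c @^-1` [set i])).
pose b i := fine (m' (c @^-1` [set i])).
have aE i : m (c @^-1` [set i]) = (a i)%:E by rewrite fineK// fin_num_measure.
have bE i : m' (c @^-1` [set i]) = (b i)%:E by rewrite fineK// fin_num_measure.
have a0 i : 0 <= a i by rewrite fine_ge0.
have b0 i : 0 <= b i by rewrite fine_ge0.
have a1 : \sum_i a i = 1.
  apply: EFin_inj; rewrite -sumEFin -[RHS](probability_setT m).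
  rewrite (measure_cells _ mc)//; apply: eq_bigr => i _; rewrite setTI; exact/esym/aE.
have b1 : \sum_i b i = 1.
  apply: EFin_inj; rewrite -sumEFin -[RHS](probability_setT m').
  rewrite (measure_cells _ mc)//; apply: eq_bigr => i _; rewrite setTI; exact/esym/bE.
have [phi phi1|g [g0 ga gb gW]] :=
    finite_kantorovich _ _ _ dist_metric n z a b (W + 2 * ep) a0 b0 a1 b1.
  have := HW phi phi1.
  have := Rintegral_cells m n z c _ _ mc cz phi1.
  have := Rintegral_cells m' n z c _ _ mc cz phi1.
  rewrite !ler_norml -/(a _) -/(b _).
  by move=> /andP[? ?] /andP[? ?] ?; lra.
have ga0 i j : a i = 0 -> g i j = 0.
  move=> ai0; apply/eqP; rewrite eq_le g0 andbT -ai0 -(ga i) (bigD1 j)//=.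
  by rewrite lerDl sumr_ge0.
have gb0 i j : b j = 0 -> g i j = 0.
  move=> bj0; apply/eqP; rewrite eq_le g0 andbT -bj0 -(gb j) (bigD1 i)//=.
  by rewrite lerDl sumr_ge0.
(* Density of the plan with respect to the product of the cell masses. A pair of cells of zero
   product mass carries no mass of [g], so [wE] survives the division by zero. *)
pose w (p : 'I_n.+1 * 'I_n.+1) := g p.1 p.2 / (a p.1 * b p.2).
have w0 p : 0 <= w p by rewrite divr_ge0// mulr_ge0.
have wE p : w p * (a p.1 * b p.2) = g p.1 p.2.
  have [/eqP|ab] := eqVneq (a p.1 * b p.2) 0; last by rewrite /w divfK.
  rewrite mulf_eq0 => ab0; suff g00 : g p.1 p.2 = 0 by rewrite /w g00 !mul0r.
  by case/orP: ab0 => /eqP; [exact: ga0|exact: gb0].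
have mc2 := measurable_cell2 _ _ mc.
have cellE p : cell2 c @^-1` [set p] = (c @^-1` [set p.1]) `*` (c @^-1` [set p.2]).
  by case: p => i j; apply/seteqP; split => -[x y] /= [<- <-].
have mmE (A B : set T) : measurable A -> measurable B ->
    (m \x m')%E (A `*` B) = (m A * m' B)%E.
  by move=> mA mB; exact: product_measure1E.
have msplit (P : probability T R) B : measurable B ->
    (P B = \sum_i P (B `&` c @^-1` [set i]))%E.
  exact: measure_cells.
have wg p : ((w p)%:E * (m \x m') (cell2 c @^-1` [set p]) = (g p.1 p.2)%:E)%E.
  rewrite cellE mmE// aE bE -!EFinM; congr EFin; exact: wE.
have w1 : (\sum_p (w p)%:E * (m \x m') (cell2 c @^-1` [set p]) = 1)%E.
  under eq_bigr do rewrite wg.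
  rewrite sumEFin; congr EFin; rewrite -(pair_bigA _ (fun i j => g i j)) /= -a1.
  by apply: eq_bigr.
have [Q QE] := cell_density _ mc2 (m \x m')%E w w0 w1.
have QT : coupling m m' Q.
  split=> B mB.
  - rewrite QE; last by rewrite -[_ @^-1` _]setTI; exact: measurable_fst.
    rewrite (msplit m B mB).
    transitivity (\sum_i \sum_j (w (i, j))%:E *
        (m \x m') (fst @^-1` B `&` cell2 c @^-1` [set (i, j)]))%E.
      by rewrite pair_bigA; apply: eq_bigr => -[].
    apply: eq_bigr => i _.
    have mBi : measurable (B `&` c @^-1` [set i]) by exact: measurableI.
    have mfin : m (B `&` c @^-1` [set i]) \is a fin_num by rewrite fin_num_measure.
    rewrite -(fineK mfin); set r := fine _.
    transitivity (\sum_j (r * (w (i, j) * b j))%:E)%E.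
      apply: eq_bigr => j _.
      rewrite (_ : _ `&` _ = (B `&` c @^-1` [set i]) `*` (c @^-1` [set j])).
        rewrite mmE// bE -(fineK mfin) -!EFinM; congr EFin.
        by rewrite -/r mulrCA.
      by rewrite cellE; apply/seteqP; split => [[x y] [? [? ?]]|[x y] [[? ?] ?]].
    rewrite sumEFin -mulr_sumr; congr EFin.
    (* On a null cell both sides vanish; otherwise the densities [w (i, j)] average to 1 against
       [b], because [g] has row sums [a]. *)
    have [ai0|ai0] := eqVneq (a i) 0.
      suff -> : r = 0 by rewrite mul0r.
      apply/eqP; rewrite eq_le fine_ge0// andbT -lee_fin (fineK mfin) -ai0 -aE.
      by apply: le_measure; rewrite ?inE//; exact: subIsetr.
    rewrite -[RHS]mulr1; congr (_ * _).
    apply: (mulfI ai0); rewrite mulr1 mulr_sumr -[RHS]ga; apply: eq_bigr => j _.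
    by rewrite mulrCA; exact: wE (i, j).
  - rewrite QE; last by rewrite -[_ @^-1` _]setTI; exact: measurable_snd.
    rewrite (msplit m' B mB).
    transitivity (\sum_i \sum_j (w (i, j))%:E *
        (m \x m') (snd @^-1` B `&` cell2 c @^-1` [set (i, j)]))%E.
      by rewrite pair_bigA; apply: eq_bigr => -[].
    rewrite exchange_big /=.
    apply: eq_bigr => j _.
    have mBj : measurable (B `&` c @^-1` [set j]) by exact: measurableI.
    have mfin : m' (B `&` c @^-1` [set j]) \is a fin_num by rewrite fin_num_measure.
    rewrite -(fineK mfin); set r := fine _.
    transitivity (\sum_i (r * (w (i, j) * a i))%:E)%E.
      apply: eq_bigr => i _.
      rewrite (_ : _ `&` _ = (c @^-1` [set i]) `*` (B `&` c @^-1` [set j])).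
        rewrite mmE// aE -(fineK mfin) -!EFinM; congr EFin.
        by rewrite -/r; ring.
      by rewrite cellE; apply/seteqP; split => [[x y] [? [? ?]]|[x y] [? [? ?]]].
    rewrite sumEFin -mulr_sumr; congr EFin.
    have [bj0|bj0] := eqVneq (b j) 0.
      suff -> : r = 0 by rewrite mul0r.
      apply/eqP; rewrite eq_le fine_ge0// andbT -lee_fin (fineK mfin) -bj0 -bE.
      by apply: le_measure; rewrite ?inE//; exact: subIsetr.
    rewrite -[RHS]mulr1; congr (_ * _).
    apply: (mulfI bj0); rewrite mulr1 mulr_sumr -[RHS]gb; apply: eq_bigr => i _.
    by rewrite mulrCA [b j * _]mulrC; exact: wE (i, j).
apply: (@le_trans _ _ (\int[Q]_p (dist p.1 p.2)%:E)%E).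
  by apply: ereal_inf_lbound; exists Q.
(* An upper bound of [dist] on the product of two cells, through their centres. *)
pose f (p : 'I_n.+1 * 'I_n.+1) := dist (z p.1) (z p.2) + 2 * ep.
apply: (@le_trans _ _ (\int[Q]_p (f (cell2 c p))%:E)%E).
  apply: ge0_le_integral => //.
  - by move=> p _; rewrite lee_fin.
  - by apply/measurable_EFinP; exact: measurable_dist.
  - by apply/measurable_EFinP; exact: measurable_cells.
  - move=> [x y] _; rewrite lee_fin /f /=.
    have := dT x (z (c x)) y; have := dT (z (c x)) (z (c y)) y.
    by have := cz x; have := cz y; rewrite (dC (z (c y))) => *; lra.
have Qg p : Q (cell2 c @^-1` [set p]) = (g p.1 p.2)%:E.
  rewrite QE// (bigD1 p)//= setIid wg big1 ?adde0// => q qp.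
  rewrite (_ : _ `&` _ = set0) ?measure0 ?mule0//.
  by apply/seteqP; split => // r [/= rp rq]; rewrite -rp -rq eqxx in qp.
rewrite (integral_cells _ mc2) (eq_bigr (fun p => (g p.1 p.2 * f p)%:E)); last first.
  by move=> p _; rewrite EFinM -Qg muleC.
rewrite sumEFin -EFinD lee_fin /f.
rewrite -(pair_bigA _ (fun i j => g i j * (dist (z i) (z j) + 2 * ep))) /=.
under eq_bigr do under eq_bigr do rewrite mulrDr.
under eq_bigr do rewrite big_split /= -mulr_suml ga.
rewrite big_split /= -mulr_suml a1 mul1r (le_trans (lerD gW (lexx _)))//.
by rewrite /ep; lra.
Qed.

(** The easy half of the duality: write both integrals over [Q] through the marginals and integrate
    the pointwise bound. *)
Lemma coupling_le (m m' : probability T R) (Q : probability (T * T)%type R)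
    (psi : T -> R) (L : R) :
  coupling m m' Q -> (forall x y, psi x - psi y <= L * dist x y) ->
  \int[m]_x psi x - \int[m']_x psi x <= L * \int[Q]_p dist p.1 p.2.
Proof.
move=> [Q1 Q2] psiL.
have mpsi := lipschitz_measurable psi L psiL.
have [M psiM] := lipschitz_bounded psi L psiL.
have i1 : Q.-integrable setT (EFin \o (fun p : T * T => psi p.1)).
  apply: (probability_integrable _ _ _ _ _ M) => //.
  exact: measurableT_comp mpsi measurable_fst.
have i2 : Q.-integrable setT (EFin \o (fun p : T * T => psi p.2)).
  apply: (probability_integrable _ _ _ _ _ M) => //.
  exact: measurableT_comp mpsi measurable_snd.
have empsi : measurable_fun setT (EFin \o psi) by exact/measurable_EFinP.
have E1 : \int[m]_x psi x = \int[Q]_p psi p.1.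
  rewrite /Rintegral; congr fine.
  have <- := integral_pushforward measurable_fst empsi i1 measurableT.
  by apply: eq_measure_integral => B mB _; exact/esym/Q1.
have E2 : \int[m']_x psi x = \int[Q]_p psi p.2.
  rewrite /Rintegral; congr fine.
  have <- := integral_pushforward measurable_snd empsi i2 measurableT.
  by apply: eq_measure_integral => B mB _; exact/esym/Q2.
rewrite E1 E2 -RintegralB// -RintegralZl//; last exact: dist_integrable.
apply: le_Rintegral => //.
- exact: (integrableB measurableT i1 i2).
- exact: (integrableZl measurableT L (dist_integrable Q)).
Qed.

End CompactMetric.

(** * Iterates of the dual operator and the contraction of the Wasserstein distance *)

Lemma eigenvalue_gt0 (R : realType) (T : Type) (k : nat) (F : T -> 'I_k -> T)
    (A h : T -> R) (rho : R) (x : T) : (1 <= k)%N -> (forall x, 0 < h x) ->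
  transfer F A h x = rho * h x -> 0 < rho.
Proof.
case: k F => // k F _ h0 /esym; rewrite /transfer big_ord_recl => E.
rewrite -(pmulr_lgt0 _ (h0 x)) E ltr_pwDl ?mulr_gt0 ?expR_gt0//.
by rewrite sumr_ge0// => i _; rewrite mulr_ge0 ?expR_ge0// ltW.
Qed.

(** Each dual step moves one [P] onto the integrand. Continuity of all iterates is required since
    [is_dual_image] only tests continuous functions. *)
Lemma iter_dual_image (R : realType) (d : measure_display) (T : measurableType d)
    (dist : T -> T -> R) (P : (T -> R) -> T -> R) (m : nat -> probability T R) :
  (forall j, is_dual_image dist P (m j) (m j.+1)) ->
  forall n phi, (forall i, dcontinuous dist (iter i P phi)) ->
    \int[m n]_x phi x = \int[m 0%N]_x iter n P phi x.
Proof.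
move=> mP; elim=> [//|n IH] phi cphi.
rewrite iterSr -IH; last by move=> i; rewrite -iterSr; exact: cphi i.+1.
by rewrite /Rintegral (mP n phi)//; exact: (cphi 0%N).
Qed.

(** The order of the quantifiers makes the constants uniform over all systems with these parameters.
    The orbits of [mu] and [nu] under the dual operator are given as sequences [m] and [m']. *)
Theorem mainTheorem1 (R : realType) (theta LA D : R) :
  0 < theta < 1 ->
  exists (C lam : R), 0 < C /\ 0 < lam < 1 /\
  forall (d : measure_display) (T : measurableType d) (dist : T -> T -> R)
    (k : nat) (F : T -> 'I_k -> T) (A h : T -> R) (rho : R),
    is_metric dist -> dcompact dist -> is_borel dist ->
    (1 <= k)%N ->
    is_ICS dist F theta -> is_attractor F ->
    is_lipschitz dist A -> lipconst dist A = LA -> mdiam dist = D ->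
    spectral_radius_is dist (transfer F A) rho ->
    is_lipschitz dist h -> (forall x : T, 0 < h x) ->
    (forall x : T, transfer F A h x = rho * h x) ->
    forall (mu nu : probability T R) (m m' : nat -> probability T R),
      m 0%N = mu -> m' 0%N = nu ->
      (forall j, is_dual_image dist (normalized F A h rho) (m j) (m j.+1)) ->
      (forall j, is_dual_image dist (normalized F A h rho) (m' j) (m' j.+1)) ->
      forall n : nat,
        (W1 dist (m n) (m' n) <= (C * lam ^+ n)%:E * W1 dist mu nu)%E.
Proof.
(* The constants are fixed before any space is given, when [LA] and [D] are reals of unknown sign;
   hence the absolute values. *)
move=> thb; pose K := weight_ratio R theta `|LA|.
pose C := expR (rate R theta K * `|D|); pose lam := gap R theta K `|D|.
have K0 : 0 < K by exact: weight_ratio_gt0.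
have lam01 : 0 < lam < 1 by exact: gap01.
exists C, lam; split; first exact: expR_gt0.
split=> // d T dist k F A h rho dm dc db k1 ics _ lipA LAE DE _ liph h0 heig.
move=> mu nu m m' m0 m'0 mP m'P n.
have d0 x y : 0 <= dist x y by have [] := dm.
have Alip x y : `|A x - A y| <= `|LA| * dist x y.
  rewrite (le_trans (lipconst_le _ dm _ lipA x y))// LAE ler_wpM2r//.
  exact: ler_norm.
have dD x y : dist x y <= `|D|.
  by rewrite (le_trans (le_mdiam _ dm dc x y))// DE ler_norm.
have [x0] := probability_inhabited _ _ _ mu.
have rho0 := eigenvalue_gt0 _ _ _ _ _ _ _ x0 k1 h0 (heig x0).
have [l l0 hl] := positive_lipschitz_log_lip _ dm h dc liph h0.
have hlog := log_lip_eigenfunction _ _ _ _ _ _ _ _ _ _ dm ics (normr_ge0 LA) Alip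
  rho0 h0 heig l l0 hl.
pose P := normalized F A h rho.
have Pcontr phi j : (forall x y, `|phi x - phi y| <= dist x y) ->
    forall x y, iter j P phi x - iter j P phi y <= C * lam ^+ j * dist x y.
  by move=> phi1; exact: iter_normalized_contract.
have c0 : 0 < C * lam ^+ n.
  by case/andP: lam01 => ? _; rewrite mulr_gt0 ?exprn_gt0 ?expR_gt0.
(* Dividing by the positive factor reduces the bound by an infimum to a bound by the cost of each
   coupling [Q] of [mu] and [nu]. *)
rewrite -lee_pdivrMl//; apply: le_ereal_inf_tmp => _ [Q Qc <-].
rewrite lee_pdivrMl//.
have -> : (\int[Q]_p (dist p.1 p.2)%:E = (\int[Q]_p dist p.1 p.2)%R%:E)%E.
  by rewrite fineK//; apply: integrable_fin_num => //; exact: dist_integrable.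
rewrite -EFinM; apply: (kantorovich_le _ _ dm dc db dD) => phi phi1.
have cphi i : dcontinuous dist (iter i P phi).
  exact: (lipschitz_dcontinuous _ dm _ _ (Pcontr phi i phi1)).
rewrite (iter_dual_image _ _ _ _ _ _ mP)// (iter_dual_image _ _ _ _ _ _ m'P)//.
rewrite m0 m'0; exact: (coupling_le _ _ dm dc db dD _ _ _ _ _ Qc (Pcontr phi n phi1)).
Qed.
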